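(* Let $P$ be a preordered set, $\Lambda$ a translation of $P$, $D$ a category, and $M,N\in D^P$. Let $(M,N,\phi,\psi)$ and $(M,N,\phi',\psi')$ be any two $\Lambda$-interleavings of $M$ and $N$. Then $(M,N,\phi,\psi)$ and $(M,N,\phi',\psi')$, viewed as objects of $D^{\Sigma_\Lambda P}$, are $\widetilde{\Lambda}$-interleaved, where $\widetilde{\Lambda}:\Sigma_\Lambda P\to\Sigma_\Lambda P$ is the twisted translation induced by $\Lambda$.
   Context: A preordered set (proset) $P$ is a set with a reflexive transitive relation $\leq$; it is viewed as a category with a unique morphism $x\to y$, itself denoted $x\leq y$ or $y\geq x$, exactly when $x\leq y$. For a category $D$, $D^P$ denotes the category of functors $P\to D$ with natural transformations as morphisms. A translation of $P$ is a functor (i.e. monotone map) $\Lambda:P\to P$ such that $x\leq\Lambda(x)$ for all $x\in P$. For $M\in D^P$, $M\Lambda:=M\circ\Lambda$, and $M\eta_\Lambda:M\to M\Lambda$ is given by $(M\eta_\Lambda)(x)=M(x\leq\Lambda(x))$. For a morphism $\phi:M\to N$ in $D^P$, $\phi\Lambda:M\Lambda\to N\Lambda$ is given by $(\phi\Lambda)(x)=\phi(\Lambda(x))$. A $\Lambda$-interleaving of $M,N\in D^P$ is a pair of morphisms $\phi:M\to N\Lambda$, $\psi:N\to M\Lambda$ with $(\psi\Lambda)\phi=M\eta_{\Lambda\Lambda}$ and $(\phi\Lambda)\psi=N\eta_{\Lambda\Lambda}$; one writes it as a $4$-tuple $(M,N,\phi,\psi)$. Two representations are $\Lambda$-interleaved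 if a $\Lambda$-interleaving of them exists. These definitions apply to any proset, any translation of it, and any representations of it (in particular to $\Sigma_\Lambda P$ below). The $\Lambda$-shoelace proset $\Sigma_\Lambda P$ has underlying set $P\sqcup P'=\{i\}_{i\in P}\sqcup\{i'\}_{i\in P}$ (two copies of $P$), with, for $i,j\in P$: $i\leq j$ in $\Sigma_\Lambda P$ iff $i'\leq j'$ in $\Sigma_\Lambda P$ iff $i\leq j$ in $P$; and $i\leq j'$ in $\Sigma_\Lambda P$ iff $i'\leq j$ in $\Sigma_\Lambda P$ iff $\Lambda(i)\leq j$ in $P$. A $\Lambda$-interleaving $(M,N,\phi,\psi)$ is viewed as the functor $V:\Sigma_\Lambda P\to D$ given by $V(i)=M(i)$, $V(i')=N(i)$ for $i\in P$; $V(j\geq i)=M(j\geq i)$ and $V(j'\geq i')=N(j\geq i)$ for $j\geq i$ in $P$; $V(j'\geq i)=N(j\geq\Lambda i)\,\phi(i)$ and $V(j\geq i')=M(j\geq\Lambda i)\,\psi(i)$ whenever $j\geq\Lambda i$ in $P$. The twisted translation $\widetilde{\Lambda}$ of $\Sigma_\Lambda P$ induced by $\Lambda$ is given on objects by $\widetilde{\Lambda}(i)=(\Lambda(i))'$ and $\widetilde{\Lambda}(i')=\Lambda(i)$ for $i\in P$. *)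

(* Defs.v *)
From Stdlib Require Import RelationClasses ProofIrrelevance.

Set Implicit Arguments.
Unset Strict Implicit.
Unset Printing Implicit Defensive.

Record category := Category {
  Obj :> Type;
  Hom : Obj -> Obj -> Type;
  idm : forall x, Hom x x;
  comp : forall x y z, Hom y z -> Hom x y -> Hom x z;
  comp_idl : forall x y (f : Hom x y), comp (idm y) f = f;
  comp_idr : forall x y (f : Hom x y), comp f (idm x) = f;
  comp_assoc : forall w x y z (h : Hom y z) (g : Hom x y) (f : Hom w x),
    comp h (comp g f) = comp (comp h g) f
}.

Notation "g '\o' f" := (comp g f) (at level 40, left associativity).

Record functor (C D : category) := Functor {
  fobj :> C -> D;
  fmap : forall x y : C, Hom x y -> Hom (fobj x) (fobj y);
  fmap_id : forall x : C, fmap (idm x) = idm (fobj x);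
  fmap_comp : forall (x y z : C) (g : Hom y z) (f : Hom x y),
    fmap (g \o f) = fmap g \o fmap f
}.

Record nat_trans (C D : category) (F G : functor C D) := NatTrans {
  component :> forall x : C, Hom (F x) (G x);
  naturality : forall (x y : C) (f : Hom x y),
    component y \o fmap F f = fmap G f \o component x
}.

Program Definition fcomp (B C D : category) (G : functor C D) (F : functor B C)
    : functor B D :=
  {| fobj := fun x => G (F x);
     fmap := fun x y f => fmap G (fmap F f) |}.
Next Obligation. now rewrite !fmap_id. Qed.
Next Obligation. now rewrite !fmap_comp. Qed.

Program Definition vcomp (C D : category) (F G H : functor C D)
    (b : nat_trans G H) (a : nat_trans F G) : nat_trans F H :=
  {| component := fun x => b x \o a x |}.
Next Obligation.
  now rewrite <- comp_assoc, naturality, comp_assoc, naturality, comp_assoc.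
Qed.

Program Definition whisker (B C D : category) (F G : functor C D)
    (a : nat_trans F G) (H : functor B C) : nat_trans (fcomp F H) (fcomp G H) :=
  {| component := fun x => a (H x) |}.
Next Obligation. apply naturality. Qed.

Record proset := Proset {
  carrier :> Type;
  le : carrier -> carrier -> Prop;
  le_preorder : PreOrder le
}.

Definition le_refl (P : proset) (x : P) : le x x :=
  @PreOrder_Reflexive _ _ (le_preorder P) x.

Definition le_trans (P : proset) (x y z : P) (h : le x y) (k : le y z) : le x z :=
  @PreOrder_Transitive _ _ (le_preorder P) x y z h k.

(* Uniqueness of the morphism x -> y is proof irrelevance for [le x y]. *)
Program Definition proset_cat (P : proset) : category :=
  {| Obj := P;
     Hom := fun x y => le x y;
     idm := fun x => le_refl x;
     comp := fun x y z k h => le_trans h k |}.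
Solve All Obligations with (intros; apply proof_irrelevance).

Coercion proset_cat : proset >-> category.

Definition fmap_le (P : proset) (D : category) (M : functor P D) (x y : P)
    (h : le x y) : Hom (M x) (M y) :=
  @fmap P D M x y h.

Lemma fmap_thin (P : proset) (D : category) (M : functor P D)
    (x y : P) (h k : le x y) :
  fmap_le M h = fmap_le M k.
Proof. f_equal; apply proof_irrelevance. Qed.

Lemma fmap_comp_thin (P : proset) (D : category) (M : functor P D)
    (x y z : P) (k : le y z) (h : le x y) (l : le x z) :
  fmap_le M k \o fmap_le M h = fmap_le M l.
Proof. unfold fmap_le; rewrite <- fmap_comp; apply fmap_thin. Qed.

Record translation (P : proset) := Translation {
  tmap :> P -> P;
  tmap_mono : forall x y : P, le x y -> le (tmap x) (tmap y);
  tmap_infl : forall x : P, le x (tmap x)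
}.

Program Definition tfun (P : proset) (L : translation P)
    : functor P P :=
  {| fobj := fun x : P => L x;
     fmap := fun (x y : P) (h : le x y) => tmap_mono L h |}.
Next Obligation. apply (proof_irrelevance (le _ _)). Qed.
Next Obligation. apply (proof_irrelevance (le _ _)). Qed.

Coercion tfun : translation >-> functor.

Program Definition tcomp (P : proset) (K L : translation P) : translation P :=
  {| tmap := fun x => K (L x) |}.
Next Obligation. now do 2 apply tmap_mono. Qed.
Next Obligation. exact (le_trans (tmap_infl L x) (tmap_infl K (L x))). Qed.

Program Definition eta (P : proset) (D : category)
    (M : functor P D) (L : translation P)
    : nat_trans M (fcomp M L) :=
  {| component := fun x : P => fmap_le M (tmap_infl L x) |}.
Next Obligation.
  unfold fmap_le; rewrite <- !fmap_comp; apply fmap_thin.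
Qed.

(* The equations of natural transformations are stated componentwise, because
   [fcomp (fcomp M L) L] and [fcomp M (tcomp L L)] agree on objects and on
   morphisms by conversion, but are not themselves convertible. *)
Record interleaving (P : proset) (D : category) (L : translation P)
    (M N : functor P D) := Interleaving {
  phi : nat_trans M (fcomp N L);
  psi : nat_trans N (fcomp M L);
  psi_phi : forall x : P, vcomp (whisker psi L) phi x = eta M (tcomp L L) x;
  phi_psi : forall x : P, vcomp (whisker phi L) psi x = eta N (tcomp L L) x
}.

Definition interleaved (P : proset) (D : category) (L : translation P)
    (M N : functor P D) : Prop :=
  inhabited (interleaving L M N).

(* [inl i] is the element i of the first copy of P, [inr i] is i'. *)
Definition shoelace_le (P : proset) (L : translation P) (x y : P + P) : Prop :=
  match x, y with
  | inl i, inl j | inr i, inr j => le i j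
  | inl i, inr j | inr i, inl j => le (L i) j
  end.

Lemma shoelace_preorder (P : proset) (L : translation P) :
  PreOrder (shoelace_le L).
Proof.
  split.
  - intros [i | i]; apply le_refl.
  - intros [i | i] [j | j] [k | k]; simpl; intros h h';
      solve [ exact (le_trans h h')
            | exact (le_trans (tmap_mono L h) h')
            | exact (le_trans (le_trans (tmap_infl L i) h)
                       (le_trans (tmap_infl L j) h')) ].
Qed.

Definition shoelace (P : proset) (L : translation P) : proset :=
  Proset (shoelace_preorder L).

Definition shoelace_obj (P : proset) (D : category) (L : translation P)
    (M N : functor P D) (x : shoelace L) : D :=
  match x with inl i => M i | inr i => N i end.

Definition shoelace_map (P : proset) (D : category) (L : translation P)
    (M N : functor P D) (I : interleaving L M N)
    (x y : shoelace L)
    : le x y -> Hom (shoelace_obj M N x) (shoelace_obj M N y) :=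
  match x, y with
  | inl i, inl j => fun h : le i j => fmap_le M h
  | inr i, inr j => fun h : le i j => fmap_le N h
  | inl i, inr j => fun h : le (L i) j => fmap_le N h \o phi I i
  | inr i, inl j => fun h : le (L i) j => fmap_le M h \o psi I i
  end.

Lemma shoelace_map_id (P : proset) (D : category) (L : translation P)
    (M N : functor P D) (I : interleaving L M N) (x : shoelace L) :
  shoelace_map I (le_refl x) = idm (shoelace_obj M N x).
Proof.
  destruct x as [i | i]; simpl; rewrite <- fmap_id; apply fmap_thin.
Qed.

Lemma turn_right (P : proset) (D : category) (L : translation P)
    (M N : functor P D) (a : nat_trans M (fcomp N L))
    (i j k : P) (h : le i j) (h' : le (L j) k) (l : le (L i) k) :
  fmap_le N l \o a i =
  fmap_le N h' \o a j \o fmap_le M h.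
Proof.
  assert (n : @comp D _ _ (N (L j)) (a j) (fmap_le M h) =
              @comp D _ (N (L i)) (N (L j)) (fmap_le N (tmap_mono L h)) (a i))
    by exact (@naturality _ _ _ _ a i j h).
  rewrite <- comp_assoc, n, comp_assoc; f_equal.
  symmetry; exact (fmap_comp_thin N h' (tmap_mono L h) l).
Qed.

Lemma turn_twice (P : proset) (D : category) (L : translation P)
    (M N : functor P D)
    (a : nat_trans M (fcomp N L)) (b : nat_trans N (fcomp M L))
    (e : forall x : P, vcomp (whisker b L) a x = eta M (tcomp L L) x)
    (i j k : P) (h : le (L i) j) (h' : le (L j) k) (l : le i k) :
  fmap_le M l =
  fmap_le M h' \o b j \o
    (fmap_le N h \o a i).
Proof.
  pose proof (le_trans (tmap_mono L h) h') as m.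
  rewrite comp_assoc, <- (turn_right b h h' m), <- comp_assoc.
  change (b (L i) \o a i) with (vcomp (whisker b L) a i).
  rewrite e; symmetry.
  exact (fmap_comp_thin M m (tmap_infl (tcomp L L) i) l).
Qed.

Lemma shoelace_map_comp (P : proset) (D : category) (L : translation P)
    (M N : functor P D) (I : interleaving L M N)
    (x y z : shoelace L) (k : le y z) (h : le x y) :
  shoelace_map I (le_trans h k) = shoelace_map I k \o shoelace_map I h.
Proof.
  generalize (le_trans h k); revert h k.
  destruct x as [x | x], y as [y | y], z as [z | z]; simpl; intros h k l;
    first [ symmetry; apply fmap_comp_thin
          | apply turn_right
          | rewrite comp_assoc; f_equal; symmetry; apply fmap_comp_thin
          | apply turn_twice; apply psi_phi
          | apply turn_twice; apply phi_psi ].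
Qed.

Definition interleaving_functor (P : proset) (D : category) (L : translation P)
    (M N : functor P D) (I : interleaving L M N)
    : functor (shoelace L) D :=
  Functor (C := proset_cat (shoelace L)) (shoelace_map_id I) (shoelace_map_comp I).

Definition twist (P : proset) (L : translation P) (x : shoelace L) : shoelace L :=
  match x with inl i => inr (L i) | inr i => inl (L i) end.

Lemma twist_mono (P : proset) (L : translation P) (x y : shoelace L) :
  le x y -> le (twist x) (twist y).
Proof. destruct x, y; simpl; apply tmap_mono. Qed.

Lemma twist_infl (P : proset) (L : translation P) (x : shoelace L) :
  le x (twist x).
Proof. destruct x; apply (@le_refl P). Qed.

Definition twisted (P : proset) (L : translation P) : translation (shoelace L) :=
  Translation (@twist_mono P L) (@twist_infl P L).

(* Main.v *)
Require Import Defs.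

Set Implicit Arguments.
Unset Strict Implicit.

(** Write I = (M, N, phi_I, psi_I) and J = (M, N, phi_J, psi_J).  On the first
    copy of P the twisted translation asks for maps M(i) -> N(L i), on the second
    for maps N(i) -> M(L i), so the given [phi]s and [psi]s are the available
    candidates.  Taking both from the same interleaving fails in general:
    for i <= j' with components (phi_I, psi_I), naturality would force
    psi_J phi_I = psi_I phi_I.
    The mixed choice (phi_I, psi_J) from I to J works ([crossing]).  For i <= j',
    both sides of the naturality square carry the same composite psi_J phi_I; for
    i' <= j, one side carries phi_I psi_I and the other phi_J psi_J, and both of
    these are the structure map of N, whatever the interleaving.

    The crossing from J to I is then (phi_J, psi_I), so composing the two pairs
    each phi with the psi of its own interleaving: the composites are psi_I phi_I
    and phi_J psi_J in one order, psi_J phi_J and phi_I psi_I in the other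
    ([crossing_crossing]). *)

(** Naturality of a, with an arbitrary inequality k: in the squares below, k is
    the twist of an inequality of the shoelace and not literally [tmap_mono]
    applied to h. *)
Lemma slide (P : proset) (L : translation P) (D : category) (M N : functor P D)
    (a : nat_trans M (fcomp N L)) (i j : P) (h : le i j) (k : le (L i) (L j)) :
  @comp D _ _ (N (L j)) (a j) (fmap_le M h) = fmap_le N k \o a i.
Proof.
  rewrite (fmap_thin N k (tmap_mono L h)).
  exact (@naturality _ _ _ _ a i j h).
Qed.

Definition crossing_component (P : proset) (L : translation P) (D : category)
    (M N : functor P D) (I J : interleaving L M N) (x : shoelace L)
    : Hom (shoelace_obj M N x) (shoelace_obj M N (twist x)) :=
  match x with inl i => phi I i | inr i => psi J i end.

Lemma crossing_natural (P : proset) (L : translation P) (D : category)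
    (M N : functor P D) (I J : interleaving L M N) (x y : shoelace L)
    (h : le x y) :
  crossing_component I J y \o shoelace_map I h =
  shoelace_map J (twist_mono h) \o crossing_component I J x.
Proof.
  generalize (twist_mono h); revert h.
  destruct x as [i | i], y as [j | j]; simpl; intros h k.
  - exact (slide (phi I) h k).
  - rewrite comp_assoc; f_equal; exact (slide (psi J) h k).
  - (* Sliding phi_I past M(h) exposes phi_I psi_I, which is traded for
       phi_J psi_J. *)
    rewrite comp_assoc.
    etransitivity; [apply f_equal2; [exact (slide (phi I) h k) | reflexivity] |].
    rewrite <- !comp_assoc; f_equal.
    exact (eq_trans (phi_psi I i) (eq_sym (phi_psi J i))).
  - exact (slide (psi J) h k).
Qed.

Definition crossing (P : proset) (L : translation P) (D : category)
    (M N : functor P D) (I J : interleaving L M N)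
    : nat_trans (interleaving_functor I)
        (fcomp (interleaving_functor J) (twisted L)) :=
  @NatTrans _ _ (interleaving_functor I)
    (fcomp (interleaving_functor J) (twisted L))
    (crossing_component I J) (@crossing_natural P L D M N I J).

(** Two crossings return to the starting copy of P, two steps of L further
    along, and meet phi and psi of a single interleaving: I over the first copy,
    J over the second. *)
Lemma crossing_crossing (P : proset) (L : translation P) (D : category)
    (M N : functor P D) (I J : interleaving L M N) (x : shoelace L) :
  vcomp (whisker (crossing J I) (twisted L)) (crossing I J) x =
  eta (interleaving_functor I) (tcomp (twisted L) (twisted L)) x.
Proof.
  destruct x as [i | i].
  - etransitivity; [exact (psi_phi I i) | exact (@fmap_thin P D M i (L (L i)) _ _)].
  - etransitivity; [exact (phi_psi J i) | exact (@fmap_thin P D N i (L (L i)) _ _)].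
Qed.

Theorem theorem4p4 (P : proset) (L : translation P) (D : category)
  (M N : functor P D) (I J : interleaving L M N) :
  interleaved (twisted L) (interleaving_functor I) (interleaving_functor J).
Proof.
  constructor.
  exact (Interleaving (crossing_crossing I J) (crossing_crossing J I)).
Qed.
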